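(* Let $G$ be a strongly paratopological gyrogroup. Then $G$ is topologically isomorphic to a subgyrogroup of a topological product of first-countable $T_1$ strongly paratopological gyrogroups if and only if $G$ is $T_1$, $G$ is $\omega$-balanced, and $wHs(G)\leq\omega$.
   Context: A gyrogroup is a nonempty set $G$ with a binary operation $\oplus$ such that: (G1) there is $0\in G$ with $0\oplus x=x=x\oplus 0$ for all $x\in G$; (G2) each $x\in G$ has an inverse $\ominus x\in G$ with $\ominus x\oplus x=0=x\oplus(\ominus x)$; (G3) for all $x,y\in G$ there is an automorphism $\mathrm{gyr}[x,y]$ of $(G,\oplus)$ with $x\oplus(y\oplus z)=(x\oplus y)\oplus \mathrm{gyr}[x,y](z)$ for all $z\in G$; (G4) $\mathrm{gyr}[x\oplus y,y]=\mathrm{gyr}[x,y]$ for all $x,y\in G$. A subgyrogroup is a nonempty subset closed under $\oplus$ and $\ominus$. Products of gyrogroups carry the coordinatewise operation; a topological isomorphism is a bijective homomorphism (a map preserving $\oplus$) that is a homeomorphism; subgyrogroups carry the subspace topology. A paratopological gyrogroup is a gyrogroup with a topology for which $\oplus:G\times G\to G$ is (jointly) continuous. It is a strongly paratopological gyrogroup if there is a neighborhood base $\mathcal U$ at $0$ such that $\mathrm{gyr}[x,y](U)=U$ for all $U\in\mathcal U$ and $x,y\in G$. No separation axioms are assumed unless stated. A family $\gamma$ of open neighborhoods of $0$ is subordinated to a neighborhood $U$ of $0$ if (1) for all $x,y\in G$ there is $V\in\gamma$ with $\ominus(x\oplus y)\oplus((V\oplus x)\oplus y)\subseteq U$, and (2)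 for all $x,y\in G$ there is $V\in\gamma$ with $V\subseteq\ominus(x\oplus y)\oplus((U\oplus x)\oplus y)$. A paratopological gyrogroup $G$ is $\omega$-balanced if for every neighborhood $U$ of $0$ there is a countable family of open neighborhoods of $0$ subordinated to $U$. (Operations on sets are elementwise.) The weakly Hausdorff number $wHs(G)$ of a $T_1$ paratopological gyrogroup $G$ is the minimum cardinal $\kappa$ such that for every neighborhood $U$ of $0$ there is a family $\gamma$ of neighborhoods of $0$ with $|\gamma|\le\kappa$ and $\bigcap_{V\in\gamma}(\ominus V)\subseteq U$, where $\ominus V=\{\ominus v:v\in V\}$. *)

(* Defs.v *)
From HB Require Import structures.
From mathcomp Require Import all_boot all_classical topology.

Set Implicit Arguments.
Unset Strict Implicit.
Unset Printing Implicit Defensive.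

Local Open Scope classical_set_scope.
Local Open Scope card_scope.

Declare Scope gyro_scope.
Delimit Scope gyro_scope with gyro.
Reserved Notation "x ⊕ y" (at level 50, left associativity).
Reserved Notation "⊖ x" (at level 35, right associativity).
Local Open Scope gyro_scope.

(* The gyration is carried as data; by left cancellation (see gyrE below) it is
   determined by the operation. *)
HB.mixin Record isGyrogroup (G : Type) := {
  gzero : G ;
  gadd : G -> G -> G ;
  gopp : G -> G ;
  gyr : G -> G -> G -> G ;
  gadd0g : forall x, gadd gzero x = x ;
  gaddg0 : forall x, gadd x gzero = x ;
  gaddNg : forall x, gadd (gopp x) x = gzero ;
  gaddgN : forall x, gadd x (gopp x) = gzero ;
  gyr_bij : forall x y, bijective (gyr x y) ;
  gyrD : forall x y, {morph gyr x y : z w / gadd z w} ;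
  gaddA_gyr : forall x y z, gadd x (gadd y z) = gadd (gadd x y) (gyr x y z) ;
  gyr_loop : forall x y, gyr (gadd x y) y =1 gyr x y
}.

#[short(type="gyrogroupType")]
HB.structure Definition Gyrogroup := {G of isGyrogroup G}.

Notation "x ⊕ y" := (gadd x y) : gyro_scope.
Notation "⊖ x" := (gopp x) : gyro_scope.

Section GyrogroupTheory.
Context {G : gyrogroupType}.
Implicit Types x y z a b : G.

Lemma gaddIg a : injective (gadd a).
Proof.
move=> b c /(congr1 (gadd (⊖ a))); rewrite !gaddA_gyr gaddNg !gadd0g.
exact: (bij_inj (gyr_bij _ _)).
Qed.

Lemma gyr0g a : gyr gzero a =1 id.
Proof. by move=> z; apply: (@gaddIg a); rewrite -[RHS]gadd0g gaddA_gyr gadd0g. Qed.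

Lemma gaddKg a b : ⊖ a ⊕ (a ⊕ b) = b.
Proof. by rewrite gaddA_gyr gaddNg gadd0g -gyr_loop gaddNg gyr0g. Qed.

Lemma gaddNKg a b : a ⊕ (⊖ a ⊕ b) = b.
Proof. by rewrite gaddA_gyr gaddgN gadd0g -gyr_loop gaddgN gyr0g. Qed.

Lemma gyrE x y z : gyr x y z = ⊖ (x ⊕ y) ⊕ (x ⊕ (y ⊕ z)).
Proof. by rewrite [x ⊕ (y ⊕ z)]gaddA_gyr gaddKg. Qed.

End GyrogroupTheory.

#[short(type="topGyrogroupType")]
HB.structure Definition TopGyrogroup := {G of Topological G & Gyrogroup G}.

HB.mixin Record isParaTopGyrogroup G of TopGyrogroup G := {
  gadd_continuous : continuous (fun p : G * G => p.1 ⊕ p.2)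
}.

#[short(type="paraTopGyrogroupType")]
HB.structure Definition ParaTopGyrogroup :=
  {G of TopGyrogroup G & isParaTopGyrogroup G}.

Definition nbhs_base (T : topologicalType) (x : T) (B : set (set T)) :=
  (forall U, B U -> nbhs x U) /\
  (forall W, nbhs x W -> exists2 U, B U & U `<=` W).

Definition first_countable (T : topologicalType) :=
  forall x : T, exists2 B : set (set T), countable B & nbhs_base x B.

HB.mixin Record isStronglyParaTopGyrogroup G of ParaTopGyrogroup G := {
  gyr_invariant_base : exists B : set (set G), nbhs_base gzero B /\
    forall U, B U -> forall x y : G, gyr x y @` U = U
}.

#[short(type="strongParaTopGyrogroupType")]
HB.structure Definition StronglyParaTopGyrogroup :=
  {G of ParaTopGyrogroup G & isStronglyParaTopGyrogroup G}.

Section OmegaBalanced.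
Variable G : paraTopGyrogroupType.

Definition subordinated (gamma : set (set G)) (U : set G) :=
  (forall x y : G, exists2 V, gamma V &
     [set ⊖ (x ⊕ y) ⊕ ((v ⊕ x) ⊕ y) | v in V] `<=` U) /\
  (forall x y : G, exists2 V, gamma V &
     V `<=` [set ⊖ (x ⊕ y) ⊕ ((u ⊕ x) ⊕ y) | u in U]).

Definition omega_balanced :=
  forall U : set G, nbhs gzero U ->
    exists gamma : set (set G),
      [/\ countable gamma,
          forall V, gamma V -> open_nbhs gzero V
        & subordinated gamma U].

End OmegaBalanced.

(* A cardinal is represented by a set (in an arbitrary type), compared with #<=.
   The weakly Hausdorff number, meaningful for T1 spaces, is then a minimum. *)
Section WeaklyHausdorffNumber.
Variable G : paraTopGyrogroupType.

Definition wHs_bound (X : Type) (kappa : set X) :=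
  forall U : set G, nbhs gzero U ->
    exists gamma : set (set G),
      [/\ forall V, gamma V -> nbhs gzero V,
          gamma #<= kappa
        & \bigcap_(V in gamma) [set ⊖ v | v in V] `<=` U].

Definition is_wHs (X : Type) (kappa : set X) :=
  wHs_bound kappa /\
  forall (Y : Type) (lambda : set Y), wHs_bound lambda -> kappa #<= lambda.

Definition wHs_le (Y : Type) (lambda : set Y) :=
  exists (X : Type) (kappa : set X), is_wHs kappa /\ kappa #<= lambda.

End WeaklyHausdorffNumber.

Section ProductGyrogroup.
Variables (I : Type) (H : I -> topGyrogroupType).
Implicit Types f g h : prod_topology H.

Definition prod_gzero : prod_topology H := fun i => gzero.
Definition prod_gadd f g : prod_topology H := fun i => f i ⊕ g i.
Definition prod_gopp f : prod_topology H := fun i => ⊖ f i.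
Definition prod_gyr f g h : prod_topology H := fun i => gyr (f i) (g i) (h i).

Lemma prod_gadd0g f : prod_gadd prod_gzero f = f.
Proof. by apply: functional_extensionality_dep => i; exact: gadd0g. Qed.

Lemma prod_gaddg0 f : prod_gadd f prod_gzero = f.
Proof. by apply: functional_extensionality_dep => i; exact: gaddg0. Qed.

Lemma prod_gaddNg f : prod_gadd (prod_gopp f) f = prod_gzero.
Proof. by apply: functional_extensionality_dep => i; exact: gaddNg. Qed.

Lemma prod_gaddgN f : prod_gadd f (prod_gopp f) = prod_gzero.
Proof. by apply: functional_extensionality_dep => i; exact: gaddgN. Qed.

Lemma prod_gyr_bij f g : bijective (prod_gyr f g).
Proof.
have inv i : {k | cancel (gyr (f i) (g i)) k /\ cancel k (gyr (f i) (g i))}.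
  by apply: cid; case: (gyr_bij (f i) (g i)) => k kK Kk; exists k.
exists (fun h i => sval (inv i) (h i)) => h;
  apply: functional_extensionality_dep => i; rewrite /prod_gyr;
  by case: (inv i) => k [/= kK Kk]; rewrite ?kK ?Kk.
Qed.

Lemma prod_gyrD f g : {morph prod_gyr f g : h k / prod_gadd h k}.
Proof. by move=> h k; apply: functional_extensionality_dep => i; exact: gyrD. Qed.

Lemma prod_gaddA_gyr f g h :
  prod_gadd f (prod_gadd g h) = prod_gadd (prod_gadd f g) (prod_gyr f g h).
Proof. by apply: functional_extensionality_dep => i; exact: gaddA_gyr. Qed.

Lemma prod_gyr_loop f g : prod_gyr (prod_gadd f g) g =1 prod_gyr f g.
Proof. by move=> h; apply: functional_extensionality_dep => i; exact: gyr_loop. Qed.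

HB.instance Definition _ := isGyrogroup.Build (prod_topology H)
  prod_gadd0g prod_gaddg0 prod_gaddNg prod_gaddgN
  prod_gyr_bij prod_gyrD prod_gaddA_gyr prod_gyr_loop.

End ProductGyrogroup.

Record subgyrogroup (G : gyrogroupType) := Subgyrogroup {
  subgyro_set :> set G ;
  subgyro_nonempty : subgyro_set !=set0 ;
  subgyro_add : forall x y, subgyro_set x -> subgyro_set y -> subgyro_set (x ⊕ y) ;
  subgyro_opp : forall x, subgyro_set x -> subgyro_set (⊖ x)
}.

Section SubgyrogroupIsGyrogroup.
Variables (G : topGyrogroupType) (S : subgyrogroup G).
Implicit Types x y z : S.

Lemma subgyro_zero : subgyro_set S gzero.
Proof.
by have [x Sx] := subgyro_nonempty S; rewrite -(gaddNg x);
  apply: subgyro_add => //; exact: subgyro_opp.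
Qed.

Lemma subgyro_gyr (x y z : G) :
  subgyro_set S x -> subgyro_set S y -> subgyro_set S z ->
  subgyro_set S (gyr x y z).
Proof.
move=> Sx Sy Sz; rewrite gyrE.
apply: subgyro_add; first by apply: subgyro_opp; exact: subgyro_add.
by apply: subgyro_add => //; exact: subgyro_add.
Qed.

Definition sub_gzero : S := exist _ gzero (mem_set subgyro_zero).
Definition sub_gadd x y : S :=
  exist _ (val x ⊕ val y) (mem_set (subgyro_add (set_valP x) (set_valP y))).
Definition sub_gopp x : S :=
  exist _ (⊖ val x) (mem_set (subgyro_opp (set_valP x))).
Definition sub_gyr x y z : S :=
  exist _ (gyr (val x) (val y) (val z))
    (mem_set (subgyro_gyr (set_valP x) (set_valP y) (set_valP z))).

Lemma sub_gadd0g x : sub_gadd sub_gzero x = x.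
Proof. by apply: val_inj; exact: gadd0g. Qed.

Lemma sub_gaddg0 x : sub_gadd x sub_gzero = x.
Proof. by apply: val_inj; exact: gaddg0. Qed.

Lemma sub_gaddNg x : sub_gadd (sub_gopp x) x = sub_gzero.
Proof. by apply: val_inj; exact: gaddNg. Qed.

Lemma sub_gaddgN x : sub_gadd x (sub_gopp x) = sub_gzero.
Proof. by apply: val_inj; exact: gaddgN. Qed.

Lemma sub_gyr_bij x y : bijective (sub_gyr x y).
Proof.
exists (fun w =>
  sub_gadd (sub_gopp y) (sub_gadd (sub_gopp x) (sub_gadd (sub_gadd x y) w))) => z;
  apply: val_inj => /=; first by rewrite -gaddA_gyr !gaddKg.
by rewrite gyrE !gaddNKg gaddKg.
Qed.

Lemma sub_gyrD x y : {morph sub_gyr x y : z w / sub_gadd z w}.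
Proof. by move=> z w; apply: val_inj; exact: gyrD. Qed.

Lemma sub_gaddA_gyr x y z :
  sub_gadd x (sub_gadd y z) = sub_gadd (sub_gadd x y) (sub_gyr x y z).
Proof. by apply: val_inj; exact: gaddA_gyr. Qed.

Lemma sub_gyr_loop x y : sub_gyr (sub_gadd x y) y =1 sub_gyr x y.
Proof. by move=> z; apply: val_inj; exact: gyr_loop. Qed.

(* The library's topology on set_type S is the initial one for the inclusion. *)
HB.instance Definition _ := isGyrogroup.Build (set_type S)
  sub_gadd0g sub_gaddg0 sub_gaddNg sub_gaddgN
  sub_gyr_bij sub_gyrD sub_gaddA_gyr sub_gyr_loop.

End SubgyrogroupIsGyrogroup.

Definition topological_isomorphism (G H : topGyrogroupType) (f : G -> H) :=
  [/\ {morph f : x y / x ⊕ y}, continuous f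
    & exists g : H -> G, [/\ cancel f g, cancel g f & continuous g]].

Definition topologically_isomorphic (G H : topGyrogroupType) :=
  exists f : G -> H, topological_isomorphism f.

(* Main.v *)
From HB Require Import structures.
Require Import Defs.
From mathcomp Require Import all_boot all_classical topology.

(** For the "if" part, every neighbourhood U of 0 is pulled back from a
    first-countable T1 quotient of G, and G embeds diagonally in the product of
    these quotients. To build one, put U (up to shrinking) in a countable family N
    of gyr-invariant neighbourhoods of 0 that is closed under halving, finite
    intersections and subordination, and in which every V contains the
    intersection of all - W. Then N is a base at 0 of a coarser paratopological
    gyrogroup topology; by the last property its specialization preorder is
    symmetric, so its T0 quotient is T1. For the "only if" part, the sets having a
    countable subordinated family that also witnesses wHs <= omega form a filter
    stable under preimage, which reduces the claim to one first-countable factor;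
    there the point is that right translations are homeomorphisms although - is
    not continuous, by the Bol identity. *)

Set Implicit Arguments.
Unset Strict Implicit.
Unset Printing Implicit Defensive.

Local Open Scope classical_set_scope.
Local Open Scope card_scope.
Local Open Scope gyro_scope.

(** * Algebra: the Bol identity and the inverses of right translations *)

Section GyrogroupAlgebra.
Context {G : gyrogroupType}.
Implicit Types x y z a b : G.

Lemma goppK x : ⊖ ⊖ x = x.
Proof. by apply: (@gaddIg G (⊖ x)); rewrite gaddgN gaddNg. Qed.

Lemma gopp0 : ⊖ (gzero : G) = gzero.
Proof. by rewrite -[LHS]gadd0g gaddgN. Qed.

Lemma gyrg0 x y : gyr x y gzero = gzero.
Proof. by apply: (@gaddIg G (gyr x y gzero)); rewrite -gyrD !gaddg0. Qed.

Lemma gyrVl x y z : gyr (⊖ x) (x ⊕ y) (gyr x y z) = z.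
Proof. by rewrite gyrE gaddKg -[RHS](gaddKg y) -gaddA_gyr gaddKg. Qed.

(** The loop property at [⊖ x] and [x ⊕ y] turns the first argument [⊖ x] in [gyrVl] into [y]. *)
Lemma gyrVr x y z : gyr y (x ⊕ y) (gyr x y z) = z.
Proof.
by have := gyr_loop (⊖ x) (x ⊕ y); rewrite gaddKg => ->; exact: gyrVl.
Qed.

Lemma gyrKadd x y z : (x ⊕ y) ⊕ gyr x y z = x ⊕ (y ⊕ z).
Proof. by rewrite gaddA_gyr. Qed.

(** Reassociating from the inside out creates [gyr y x] and then [gyr x (y ⊕ x)], which cancel by
    [gyrVr]. *)
Lemma gyro_bol x y z : x ⊕ (y ⊕ (x ⊕ z)) = (x ⊕ (y ⊕ x)) ⊕ z.
Proof. by rewrite (gaddA_gyr y) gaddA_gyr gyrVr. Qed.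

(* The Bol identity gives R_(x + z) = L_x^-1 R_z L_x R_x for the translations,
   so that (z := - x) the inverse of R_x is L_x^-1 R_(-x) L_x; unlike the usual
   formula u |-> u + gyr[u, x](- x), this one does not involve - u. *)
Definition grdiv x a : G := ⊖ x ⊕ ((x ⊕ a) ⊕ ⊖ x).

Lemma gaddgK x : cancel (gadd^~ x) (grdiv x).
Proof. by move=> u; rewrite /grdiv -gyro_bol gaddgN gaddg0 gaddKg. Qed.

(** [gaddgK] gives one side; as a composite of injective translations, [grdiv x] is itself
    injective, which gives the other. *)
Lemma grdivK x : cancel (grdiv x) (gadd^~ x).
Proof.
move=> u; have grdiv_inj : injective (grdiv x).
  by move=> a b /gaddIg /(can_inj (gaddgK (⊖ x))) /gaddIg.
by apply: grdiv_inj; rewrite gaddgK.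
Qed.

(** The map underlying [subordinated]. Being a composite of translations, it has an inverse,
    [gunshift], that never applies [⊖] to its argument. *)
Definition gshift x y v : G := ⊖ (x ⊕ y) ⊕ ((v ⊕ x) ⊕ y).

Definition gunshift x y v : G := grdiv x (grdiv y ((x ⊕ y) ⊕ v)).

Lemma gshiftK x y : cancel (gshift x y) (gunshift x y).
Proof. by move=> v; rewrite /gunshift /gshift gaddNKg !gaddgK. Qed.

Lemma gunshiftK x y : cancel (gunshift x y) (gshift x y).
Proof. by move=> v; rewrite /gunshift /gshift !grdivK gaddKg. Qed.

Lemma gshift0 x y : gshift x y gzero = gzero.
Proof. by rewrite /gshift gadd0g gaddNg. Qed.

Lemma gunshift0 x y : gunshift x y gzero = gzero.
Proof. by rewrite -{1}(gshift0 x y) gshiftK. Qed.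

(** Trading the image for a preimage makes the second half of [subordinated] accessible to the
    continuity of [gunshift]. *)
Lemma image_gshift x y (U : set G) :
  [set ⊖ (x ⊕ y) ⊕ ((u ⊕ x) ⊕ y) | u in U] = gunshift x y @^-1` U.
Proof.
rewrite predeqE => v; split=> [[u Uu <-]|Uv].
  by rewrite -[_ ⊕ _]/(gshift x y u) /= gshiftK.
by exists (gunshift x y v) => //; exact: gunshiftK.
Qed.

End GyrogroupAlgebra.

Section GyrogroupMorphism.
Variables (G H : gyrogroupType) (f : G -> H).
Hypothesis fD : {morph f : x y / x ⊕ y}.

Lemma gmorph0 : f gzero = gzero.
Proof. by apply: (@gaddIg H (f gzero)); rewrite -fD !gaddg0. Qed.

Lemma gmorphN : {morph f : x / ⊖ x}.
Proof. by move=> x; apply: (@gaddIg H (f x)); rewrite -fD !gaddgN gmorph0. Qed.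

Lemma gmorph_gshift x y v : f (gshift x y v) = gshift (f x) (f y) (f v).
Proof. by rewrite /gshift fD gmorphN !fD. Qed.

Lemma gmorph_gunshift x y v : f (gunshift x y v) = gunshift (f x) (f y) (f v).
Proof.
apply: (can_inj (gshiftK (f x) (f y))).
by rewrite -gmorph_gshift !gunshiftK.
Qed.

End GyrogroupMorphism.

(** * Continuity of translations and of their inverses *)

Section ParaTopGyrogroupTheory.
Context {G : paraTopGyrogroupType}.
Implicit Types x y : G.

Lemma nbhs_gadd x y (A : set G) : nbhs (x ⊕ y) A ->
  exists P Q, [/\ nbhs x P, nbhs y Q & forall p q, P p -> Q q -> A (p ⊕ q)].
Proof.
move=> /(@gadd_continuous G (x, y))[[P Q] /= [xP yQ] sA].
by exists P, Q; split=> // p q Pp Qq; apply: (sA (p, q)).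
Qed.

Lemma continuous_gaddl x : continuous (gadd x).
Proof.
move=> y A /nbhs_gadd[P [Q [xP yQ sA]]]; apply: filterS yQ => q Qq.
exact: sA (nbhs_singleton xP) Qq.
Qed.

Lemma continuous_gaddr x : continuous (gadd^~ x).
Proof.
move=> y A /nbhs_gadd[P [Q [xP yQ sA]]]; apply: filterS xP => p Pp.
exact: sA Pp (nbhs_singleton yQ).
Qed.

Lemma continuous_grdiv x : continuous (grdiv x).
Proof.
move=> u; apply: (@continuous_comp _ _ _ (fun a => (x ⊕ a) ⊕ ⊖ x)).
  by apply: (@continuous_comp _ _ _ (gadd x) (gadd^~ (⊖ x)));
    [exact: continuous_gaddl|exact: continuous_gaddr].
exact: continuous_gaddl.
Qed.

Lemma continuous_gshift x y : continuous (gshift x y).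
Proof.
move=> u; apply: (@continuous_comp _ _ _ (fun a => (a ⊕ x) ⊕ y)).
  by apply: (@continuous_comp _ _ _ (gadd^~ x) (gadd^~ y));
    exact: continuous_gaddr.
exact: continuous_gaddl.
Qed.

Lemma continuous_gunshift x y : continuous (gunshift x y).
Proof.
move=> u; apply: (@continuous_comp _ _ _ (fun a => grdiv y ((x ⊕ y) ⊕ a))).
  by apply: (@continuous_comp _ _ _ (gadd (x ⊕ y)) (grdiv y));
    [exact: continuous_gaddl|exact: continuous_grdiv].
exact: continuous_grdiv.
Qed.

Lemma nbhs_gtranslate x (A : set G) : nbhs x A <-> nbhs gzero (gadd x @^-1` A).
Proof.
split=> [xA|].
  by apply: (@continuous_gaddl x gzero); rewrite gaddg0.
rewrite -{1}(gaddNg x) => /(@continuous_gaddl (⊖ x) x) xA.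
by apply: (@filterS _ (nbhs x) _ _ _ _ xA) => y /=; rewrite gaddNKg.
Qed.

End ParaTopGyrogroupTheory.


(** * Necessity: the filter of countably subordinated sets *)

Section CountablySubordinated.
Variable G : paraTopGyrogroupType.

Definition countably_subordinated : set_system G := [set U |
  exists gamma : set (set G),
    [/\ countable gamma, forall V, gamma V -> open_nbhs gzero V,
        subordinated gamma U & \bigcap_(V in gamma) [set ⊖ v | v in V] `<=` U]].

Lemma countably_subordinated_filter : Filter countably_subordinated.
Proof.
split.
- exists [set setT]; split; first exact: countable1.
  + by move=> _ ->; split=> //; exact: openT.
  + by split=> x y; exists setT => // v _; rewrite image_gshift.
  + by [].
- move=> U W [gU [cU oU [sU1 sU2] iU]] [gW [cW oW [sW1 sW2] iW]].
  exists ((fun p => p.1 `&` p.2) @` (gU `*` gW)); split.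
  + exact: sub_countable (card_image_le _ _) (countableX cU cW).
  + move=> _ [[V V'] /= [/oU[oV V0] /oW[oV' V'0]] <-].
    by split=> //; exact: openI.
  + split=> x y.
      have [V gV sV] := sU1 x y; have [V' gV' sV'] := sW1 x y.
      exists (V `&` V'); first by exists (V, V').
      by move=> _ [v [Vv V'v] <-]; split; [apply: sV|apply: sV']; exists v.
    have [V gV] := sU2 x y; have [V' gV'] := sW2 x y.
    rewrite !image_gshift => sV' sV; exists (V `&` V'); first by exists (V, V').
    by move=> v [/sV Uv /sV' Wv].
  (* Subordination at a single pair shows both families nonempty; a fixed member of one is then
     paired with each member of the other. *)
  + have [V0 gV0 _] := sU1 gzero gzero; have [V0' gV0' _] := sW1 gzero gzero.
    move=> v iv; split.
      apply: iU => V gV; have [|w [Vw _] <-] := iv (V `&` V0'); last by exists w.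
      by exists (V, V0').
    apply: iW => V gV; have [|w [_ Vw] <-] := iv (V0 `&` V); last by exists w.
    by exists (V0, V).
- move=> U W UW [g [cg og [s1 s2] ig]]; exists g; split=> //; last first.
    exact: subset_trans ig UW.
  split=> x y.
    by have [V gV sV] := s1 x y; exists V => //; exact: subset_trans sV UW.
  have [V gV sV] := s2 x y; exists V => //; apply: subset_trans sV _.
  exact: image_subset.
Qed.

End CountablySubordinated.

Lemma accessible_nbhs (T : topologicalType) (x y : T) :
  accessible_space T -> (forall A, nbhs x A -> A y) -> x = y.
Proof.
move=> T1 xy; apply/eqP/negPn/negP => /T1[A [oA]]; rewrite !inE => Ax; apply.
by apply: xy; exact: open_nbhs_nbhs.
Qed.

(** The witnesses are preimages of the interiors of a countable base at [gzero]. Subordination holds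
    because [gshift] and [gunshift] are continuous, fix [gzero] and commute with [f]. *)
Lemma countably_subordinated_preimage (G H : paraTopGyrogroupType) (f : G -> H)
    (W : set H) :
  first_countable H -> accessible_space H ->
  {morph f : x y / x ⊕ y} -> continuous f -> nbhs gzero W ->
  countably_subordinated (f @^-1` W).
Proof.
move=> H1 HT1 fD fC W0; have [B cB [Bn Bb]] := H1 gzero.
have f0 := gmorph0 fD.
have Bi V : nbhs gzero V -> exists2 U, B U & U° `<=` V.
  move=> /Bb[U BU UV]; exists U => //.
  by apply: subset_trans UV; exact: interior_subset.
exists ((fun U => f @^-1` U°) @` B); split.
- exact: sub_countable (card_image_le _ _) cB.
- move=> _ [U /Bn/nbhs_interior/nbhs_singleton U0 <-].
  split; last by rewrite /= f0.
  by apply: open_comp => [x _|]; [exact: fC|exact: open_interior].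
- split=> x y.
    have /Bi[U BU sU] : nbhs gzero (gshift (f x) (f y) @^-1` W).
      by apply: continuous_gshift; rewrite gshift0.
    exists (f @^-1` U°); first by exists U.
    move=> _ [v /sU /= Wv <-] /=.
    by rewrite -[_ ⊕ _]/(gshift x y v) gmorph_gshift.
  have /Bi[U BU sU] : nbhs gzero (gunshift (f x) (f y) @^-1` W).
    by apply: continuous_gunshift; rewrite gunshift0.
  exists (f @^-1` U°); first by exists U.
  by rewrite image_gshift => v /sU /=; rewrite gmorph_gunshift.
(* Here [f (⊖ v)] lies in every neighbourhood of [gzero], so it is [gzero] by T1; hence so is
   [f v]. *)
- move=> v iv; rewrite /= -[v]goppK gmorphN//.
  suff -> : f (⊖ v) = gzero by rewrite gopp0; exact: nbhs_singleton W0.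
  apply/esym/accessible_nbhs => // V /Bi[U BU sU]; apply: sU.
  by have [|w Uw <-] := iv (f @^-1` U°); [exists U|rewrite goppK].
Qed.

(** * Neighbourhoods in products and subspaces *)

Lemma cvg_prod_topology (I : Type) (T : I -> topologicalType)
    (F : set_system (prod_topology T)) (t : prod_topology T) :
  Filter F ->
  F --> t <-> forall i (A : set (T i)), nbhs (t i) A -> F [set f | A (f i)].
Proof.
move=> FF; have cS := @cvg_sup _ _ _ F t FF; split.
  move=> /cS Ft i A tA.
  apply: (Ft i _ _).
  exact: (@initial_continuous _ _ (fun f : (forall i, T i) => f i) t A tA).
move=> Ft; apply/cS => i A [_ [[B oB <-] Bt sBA]].
by apply: filterS sBA _; apply: (Ft i); exact: open_nbhs_nbhs.
Qed.

Lemma nbhs_set_type (T : topologicalType) (S : set T) (x : S) (A : set S) :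
  nbhs x A <-> exists2 B, nbhs (set_val x) B & set_val @^-1` B `<=` A.
Proof.
split=> [[_ [[B oB <-] Bx sBA]]|[B xB sBA]].
  by exists B => //; exact: open_nbhs_nbhs.
by apply: filterS sBA _; exact: initial_continuous xB.
Qed.

(** * Necessity for a gyrogroup embedded in a product *)

Section EmbeddedGyrogroup.
Variables (G : paraTopGyrogroupType).
Variables (I : Type) (H : I -> strongParaTopGyrogroupType).
Variables (S : subgyrogroup (prod_topology H)) (f : G -> set_type S).
Hypothesis H1 : forall i, first_countable (H i) /\ accessible_space (H i).
Hypothesis ff : topological_isomorphism f.

Let e (i : I) (x : G) : H i := set_val (f x) i.

Let eD i : {morph e i : x y / x ⊕ y}.
Proof. by case: ff => fD _ _ x y; rewrite /e fD. Qed.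

Let eC i : continuous (e i).
Proof.
case: ff => _ fC _ x A xA.
suff /fC : nbhs (f x) [set s : set_type S | A (set_val s i)] by [].
apply/nbhs_set_type; exists [set h | A (h i)] => //.
have /cvg_prod_topology : nbhs (set_val (f x)) --> set_val (f x) by [].
by move=> /(_ i A xA).
Qed.

Lemma embedded_accessible : accessible_space G.
Proof.
case: ff => _ _ [g [fK _ _]] x y xy.
have [i exy] : exists i, e i x <> e i y.
  apply/existsNP => exy; move/eqP: xy; apply; apply: (can_inj fK).
  by apply: val_inj; exact/functional_extensionality_dep/exy.
have [_ /(_ _ _ (introN eqP exy))[A [oA Ax Ay]]] := H1 i.
exists (e i @^-1` A); rewrite !inE in Ax Ay *; split=> //.
by apply: open_comp => // z _; exact: eC.
Qed.

(** The image of the filter in the product converges to the image of [gzero], since it does so in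
    each coordinate. Continuity of the inverse isomorphism then puts [U] in the filter. *)
Lemma embedded_countably_subordinated (U : set G) :
  nbhs gzero U -> countably_subordinated U.
Proof.
move=> U0; case: ff => fD fC [g [fK gK gC]].
have FF := countably_subordinated_filter G.
have f0 := gmorph0 fD.
have Ff : fmap (fun x => set_val (f x)) (@countably_subordinated G) -->
    set_val (f gzero).
  apply/cvg_prod_topology => i A; rewrite f0 => A0.
  have [Hi1 HiT1] := H1 i.
  exact: (countably_subordinated_preimage Hi1 HiT1 (@eD i) (@eC i) A0).
have /gC/nbhs_set_type[B B0 sB] : nbhs (g (f gzero)) U by rewrite fK.
apply: (@filterS _ _ FF _ _ _ (Ff B B0)) => x Bx.
by rewrite -(fK x); exact: (sB (f x)).
Qed.

End EmbeddedGyrogroup.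

(** * The weakly Hausdorff number and its bounds *)

Lemma wHs_bound_card_le (G : paraTopGyrogroupType) (X Y : Type)
    (k : set X) (l : set Y) :
  k #<= l -> wHs_bound G k -> wHs_bound G l.
Proof.
move=> kl bk U /bk[gamma [? ? ?]]; exists gamma; split=> //.
exact: card_le_trans kl.
Qed.

(** The minimum demanded by [wHs_le] must be exhibited: it is the least finite bound if there is
    one; otherwise every bound is infinite and [nat] is minimal. *)
Lemma wHs_le_nat (G : paraTopGyrogroupType) :
  wHs_le G [set: nat] <-> wHs_bound G [set: nat].
Proof.
split=> [[X [k [[bk _] kn]]]|bn]; first exact: wHs_bound_card_le kn bk.
have [[n bdn]|nbd] := pselect (exists n, wHs_bound G `I_n).
  have ex : exists n, `[< wHs_bound G `I_n >] by exists n; exact/asboolP.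
  case: (ex_minnP ex) => m /asboolP bm mmin.
  exists nat, `I_m; split; last exact: subset_card_le.
  split=> // Y l bl.
  have [/finite_setP[p lp]|il] := pselect (finite_set l); last first.
    by apply: card_le_trans (subset_card_le _) ((infiniteP _).1 il).
  rewrite (card_le_eqr lp) card_le_II; apply: mmin; apply/asboolP.
  by apply: wHs_bound_card_le bl; rewrite (card_le_eql lp).
exists nat, setT; split=> //; split=> // Y l bl.
apply/infiniteP => /finite_setP[p lp]; apply: nbd; exists p.
by apply: wHs_bound_card_le bl; rewrite (card_le_eql lp).
Qed.


(** * The T0 quotient of a topological space *)

Section T0Quotient.
Variable T : topologicalType.
Implicit Types x y : T.

Lemma nbhs_eqP x y : nbhs x = nbhs y <->
  (forall A, nbhs x A -> A y) /\ (forall A, nbhs y A -> A x).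
Proof.
split=> [xy|[xy yx]].
  by split=> A; [rewrite xy|rewrite -xy]; exact: nbhs_singleton.
by rewrite eqEsubset; split=> A /nbhs_interior; [move=> /xy|move=> /yx].
Qed.

Definition t0repr x := xget x [set y | nbhs y = nbhs x].

Lemma nbhs_t0repr x : nbhs (t0repr x) = nbhs x.
Proof. by rewrite /t0repr; case: xgetP => // _ ->. Qed.

Lemma t0repr_eq x y : nbhs x = nbhs y -> t0repr x = t0repr y.
Proof.
(* Both sides now choose from the same set. Only the defaults [x] and [y] differ, and they are never
   returned because the set contains [y]. *)
move=> xy; rewrite /t0repr xy /xget; case: pselect => // -[].
by exists y; exact/asboolP.
Qed.

(* Realized on a set of representatives: as open sets are saturated, the subspace
   topology is the quotient topology. *)
Definition t0quot := set_type [set x | t0repr x = x].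

HB.instance Definition _ := Topological.copy t0quot (set_type _).

Definition t0pi x : t0quot :=
  exist _ (t0repr x) (mem_set (t0repr_eq (nbhs_t0repr x))).

Lemma t0pi_eq x y : nbhs x = nbhs y -> t0pi x = t0pi y.
Proof. by move=> xy; apply: val_inj; exact: t0repr_eq. Qed.

Lemma nbhs_val_t0pi x : nbhs (set_val (t0pi x)) = nbhs x.
Proof. exact: nbhs_t0repr. Qed.

Lemma t0piK (q : t0quot) : t0pi (set_val q) = q.
Proof. by apply: val_inj; exact: (set_valP q). Qed.

Lemma nbhs_t0pi x A : nbhs (t0pi x) A <-> nbhs x (t0pi @^-1` A).
Proof.
split=> [/nbhs_set_type[B]|xA].
  rewrite nbhs_val_t0pi => /nbhs_interior xB sBA.
  apply: filterS xB => y yB; apply: sBA => /=.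
  by apply: nbhs_singleton; rewrite nbhs_val_t0pi.
apply/nbhs_set_type; exists (t0pi @^-1` A); first by rewrite nbhs_val_t0pi.
by move=> q /=; rewrite t0piK.
Qed.

(** The interior of [V] is saturated, so its image in the quotient pulls back into [V]. *)
Lemma nbhs_t0pi_preimage x V :
  nbhs x V -> exists2 W, nbhs (t0pi x) W & t0pi @^-1` W `<=` V.
Proof.
move=> xV; exists [set q | nbhs (set_val q) V].
  apply/nbhs_t0pi; apply: filterS (nbhs_interior xV) => y.
  by rewrite /preimage /mkset nbhs_val_t0pi.
by move=> y; rewrite /preimage /mkset nbhs_val_t0pi; exact: nbhs_singleton.
Qed.

End T0Quotient.

Arguments t0pi {T} x.

(** * The gyrogroup structure on the T0 quotient *)

Section T0QuotientGyrogroup.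
Variable G : strongParaTopGyrogroupType.
Implicit Types x y z : G.
Local Notation Q := (t0quot G).
Implicit Types p q r : Q.

Lemma nbhs_gaddE x x' y y' :
  nbhs x = nbhs x' -> nbhs y = nbhs y' -> nbhs (x ⊕ y) = nbhs (x' ⊕ y').
Proof.
move=> xx yy; apply/nbhs_eqP; split=> A /nbhs_gadd[P [R [xP yR sA]]].
  by apply: sA; apply: nbhs_singleton; [rewrite -xx|rewrite -yy].
by apply: sA; apply: nbhs_singleton; [rewrite xx|rewrite yy].
Qed.

(** As [⊖] may be discontinuous, write [⊖ x] as [grdiv y (⊖ x ⊕ y)] and [⊖ y] as
    [grdiv y (⊖ x ⊕ x)]: these differ only in a summand [y] or [x], so [nbhs_gaddE] applies. *)
Lemma nbhs_goppE x y : nbhs x = nbhs y -> nbhs (⊖ x) = nbhs (⊖ y).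
Proof.
move=> xy; rewrite -(gaddgK y (⊖ x)) -(gaddgK y (⊖ y)) /= gaddNg -(gaddNg x).
by rewrite /grdiv; do 4![apply: nbhs_gaddE => //].
Qed.

Definition t0_gzero : Q := t0pi gzero.
Definition t0_gadd p q : Q := t0pi (set_val p ⊕ set_val q).
Definition t0_gopp p : Q := t0pi (⊖ set_val p).
Definition t0_gyr p q r : Q := t0pi (gyr (set_val p) (set_val q) (set_val r)).

Lemma t0piD x y : t0_gadd (t0pi x) (t0pi y) = t0pi (x ⊕ y).
Proof. by apply/t0pi_eq/nbhs_gaddE; exact: nbhs_t0repr. Qed.

Lemma t0piN x : t0_gopp (t0pi x) = t0pi (⊖ x).
Proof. by apply/t0pi_eq/nbhs_goppE/nbhs_t0repr. Qed.

Lemma t0pi_gyr x y z : t0_gyr (t0pi x) (t0pi y) (t0pi z) = t0pi (gyr x y z).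
Proof.
apply/t0pi_eq; rewrite !gyrE.
by do ![apply: nbhs_gaddE|apply: nbhs_goppE]; exact: nbhs_t0repr.
Qed.

Lemma t0_gadd0g p : t0_gadd t0_gzero p = p.
Proof. by rewrite -(t0piK p) t0piD gadd0g. Qed.

Lemma t0_gaddg0 p : t0_gadd p t0_gzero = p.
Proof. by rewrite -(t0piK p) t0piD gaddg0. Qed.

Lemma t0_gaddNg p : t0_gadd (t0_gopp p) p = t0_gzero.
Proof. by rewrite -(t0piK p) t0piN t0piD gaddNg. Qed.

Lemma t0_gaddgN p : t0_gadd p (t0_gopp p) = t0_gzero.
Proof. by rewrite -(t0piK p) t0piN t0piD gaddgN. Qed.

(** The inverse of a gyration is again a gyration, by [gyrVr], and therefore descends to the
    quotient. *)
Lemma t0_gyr_bij p q : bijective (t0_gyr p q).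
Proof.
rewrite -(t0piK p) -(t0piK q); move: (set_val p) (set_val q) => x y.
have [k kK Kk] := gyr_bij x y.
exists (t0_gyr (t0pi y) (t0pi (x ⊕ y))) => r; rewrite -(t0piK r).
  by rewrite (t0pi_gyr x) t0pi_gyr gyrVr.
by rewrite (t0pi_gyr y) t0pi_gyr -{1}(Kk (set_val r)) gyrVr Kk.
Qed.

Lemma t0_gyrD p q : {morph t0_gyr p q : r s / t0_gadd r s}.
Proof.
move=> r s; rewrite -(t0piK p) -(t0piK q) -(t0piK r) -(t0piK s).
by rewrite !(t0piD, t0pi_gyr) gyrD.
Qed.

Lemma t0_gaddA_gyr p q r :
  t0_gadd p (t0_gadd q r) = t0_gadd (t0_gadd p q) (t0_gyr p q r).
Proof.
by rewrite -(t0piK p) -(t0piK q) -(t0piK r) !(t0piD, t0pi_gyr) gaddA_gyr.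
Qed.

Lemma t0_gyr_loop p q : t0_gyr (t0_gadd p q) q =1 t0_gyr p q.
Proof.
move=> r; rewrite -(t0piK p) -(t0piK q) -(t0piK r) !(t0piD, t0pi_gyr).
by rewrite gyr_loop.
Qed.

HB.instance Definition _ := isGyrogroup.Build (t0quot G)
  t0_gadd0g t0_gaddg0 t0_gaddNg t0_gaddgN
  t0_gyr_bij t0_gyrD t0_gaddA_gyr t0_gyr_loop.

Lemma t0_gadd_continuous : continuous (fun p : Q * Q => p.1 ⊕ p.2).
Proof.
move=> [p q] A /=; rewrite -(t0piK p) -(t0piK q).
rewrite [_ ⊕ _]t0piD => /nbhs_t0pi/nbhs_gadd[P [R [pP qR sA]]].
exists (t0pi @` P, t0pi @` R) => /=.
  by split; apply/nbhs_t0pi; [apply: filterS pP|apply: filterS qR] => x;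
    exists x.
move=> [_ _] [/= [x Px <-] [y Ry <-]]; rewrite [_ ⊕ _]t0piD.
exact: sA.
Qed.

HB.instance Definition _ := isParaTopGyrogroup.Build (t0quot G) t0_gadd_continuous.

Lemma nbhs_t0pi_image x (U : set G) : nbhs x U -> nbhs (t0pi x) (t0pi @` U).
Proof. by move=> xU; apply/nbhs_t0pi; apply: filterS xU => y; exists y. Qed.

Lemma t0pi_nbhs_base x (B : set (set G)) :
  nbhs_base x B -> nbhs_base (t0pi x) [set t0pi @` U | U in B].
Proof.
move=> [Bn Bb]; split=> [_ [U BU <-]|W /nbhs_t0pi/Bb[U BU UW]].
  exact/nbhs_t0pi_image/Bn.
by exists (t0pi @` U); [exists U|move=> _ [y /UW ? <-]].
Qed.

Lemma t0_gyr_invariant_base : exists B : set (set Q), nbhs_base gzero B /\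
  forall U, B U -> forall p q : Q, gyr p q @` U = U.
Proof.
have [B [B0 Bgyr]] := @gyr_invariant_base G.
exists [set t0pi @` U | U in B]; split; first exact: t0pi_nbhs_base.
move=> _ [U BU <-] p q.
rewrite -[X in _ = t0pi @` X](Bgyr _ BU (set_val p) (set_val q)).
rewrite !image_comp; apply: eq_imagel => x _ /=.
by rewrite -{1}(t0piK p) -{1}(t0piK q) [LHS]t0pi_gyr.
Qed.

HB.instance Definition _ :=
  isStronglyParaTopGyrogroup.Build (t0quot G) t0_gyr_invariant_base.

Lemma t0quot_first_countable : first_countable G -> first_countable Q.
Proof.
move=> G1 q; rewrite -(t0piK q); have [B cB /t0pi_nbhs_base Bb] := G1 (set_val q).
by eexists; last exact: Bb; exact: sub_countable (card_image_le _ _) cB.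
Qed.

(** If every neighbourhood of one representative contained the other, symmetry would make their
    neighbourhood filters equal, hence [p = q]. *)
Lemma t0quot_accessible :
  (forall x y, (forall A, nbhs x A -> A y) -> forall A, nbhs y A -> A x) ->
  accessible_space Q.
Proof.
move=> R0 p q pq; have [A pA qA] : exists2 A, nbhs (set_val p) A & ~ A (set_val q).
  apply: contrapT => pqA; move/eqP: pq; apply.
  have pq A : nbhs (set_val p) A -> A (set_val q).
    by move=> pA; apply: contrapT => qA; apply: pqA; exists A.
  rewrite -(t0piK p) -(t0piK q); apply/t0pi_eq/nbhs_eqP; split=> //.
  exact: R0.
exists (set_val @^-1` A°); rewrite !inE; split=> //.
  by apply: open_comp => [x _|]; [exact: initial_continuous|exact: open_interior].
by move=> /interior_subset.
Qed.

End T0QuotientGyrogroup.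


(** * The topology generated by an abstract base at zero *)

Record gyro_nbhds (G : gyrogroupType) := GyroNbhds {
  gn_set : set (set G) ;
  gn_nonempty : gn_set !=set0 ;
  gn_zero : forall V, gn_set V -> V gzero ;
  gn_setI : forall V W, gn_set V -> gn_set W ->
    exists2 X, gn_set X & X `<=` V `&` W ;
  gn_add : forall V, gn_set V ->
    exists2 W, gn_set W & forall a b, W a -> W b -> V (a ⊕ b) ;
  gn_gyr : forall V, gn_set V -> forall x y, gyr x y @` V = V ;
  gn_shift : forall V, gn_set V -> forall x y,
    exists2 W, gn_set W & W `<=` gshift x y @^-1` V ;
  gn_unshift : forall V, gn_set V -> forall x y,
    exists2 W, gn_set W & W `<=` gunshift x y @^-1` V
}.

(** An alias of [G] indexed by [N], so that the new topology can coexist with the original one. *)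
Definition gyro_retop (G : topGyrogroupType) (N : gyro_nbhds G) : Type := G.

Section GyroRetop.
Variables (G : topGyrogroupType) (N : gyro_nbhds G).
Local Notation T := (gyro_retop N).
Implicit Types x y : T.

HB.instance Definition _ := Choice.on T.
HB.instance Definition _ := Gyrogroup.copy T G.

Definition retop_nbhs x : set_system T :=
  filter_from (gn_set N) (fun V => [set x ⊕ v | v in V]).

Lemma gn_gyrM V x y v : gn_set N V -> V v -> V (gyr x y v).
Proof. by move=> NV Vv; rewrite -(gn_gyr NV x y); exists v. Qed.

Lemma retop_nbhs_filter x : ProperFilter (retop_nbhs x).
Proof.
apply: filter_from_proper; last first.
  by move=> V /gn_zero V0; exists (x ⊕ gzero), gzero.
apply: filter_from_filter; first exact: gn_nonempty.
move=> V W NV NW; have [X NX XVW] := gn_setI NV NW.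
by exists X => // _ [v /XVW[Vv Wv] <-]; split; exists v.
Qed.

Lemma retop_nbhs_singleton x A : retop_nbhs x A -> A x.
Proof. by move=> [V /gn_zero V0]; apply; exists gzero => //; exact: gaddg0. Qed.

(** Invariance of [W] writes [u] as [gyr x w u'] with [u'] in [W], so that [(x ⊕ w) ⊕ u] becomes
    [x ⊕ (w ⊕ u')]. *)
Lemma retop_nbhs_nbhs x A : retop_nbhs x A -> retop_nbhs x (retop_nbhs^~ A).
Proof.
move=> [V NV sVA]; have [W NW WV] := gn_add NV.
exists W => // _ [w Ww <-]; exists W => // _ [u Wu <-].
have [u' Wu' <-] : (gyr x w @` W) u by rewrite (gn_gyr NW).
by apply: sVA; exists (w ⊕ u'); [exact: WV|rewrite gaddA_gyr].
Qed.

HB.instance Definition _ := hasNbhs.Build T retop_nbhs.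
HB.instance Definition _ := Nbhs_isNbhsTopological.Build T
  retop_nbhs_filter retop_nbhs_singleton retop_nbhs_nbhs.

Lemma retop_gadd_continuous : continuous (fun p : T * T => p.1 ⊕ p.2).
Proof.
move=> [x y] A [V NV sVA] /=; have [W NW WV] := gn_add NV.
have [W1 NW1 sW1] := gn_shift NW x y.
have [W2 NW2 sW2] := gn_unshift NW1 x gzero.
exists ([set x ⊕ v | v in W2], [set y ⊕ v | v in W]) => /=.
  by split; [exists W2|exists W].
move=> [_ _] [/= [w2 Ww2 <-] [w Ww <-]].
(* [x + w2 = u + x] for some [u] in [W1] and [(u + x) + y = (x + y) + s] for
   some [s] in [W]. *)
have /sW1 Ws := sW2 _ Ww2; set u := gunshift x gzero w2 in Ws *.
have xw : x ⊕ w2 = u ⊕ x.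
  have := gunshiftK x gzero w2; rewrite /gshift !gaddg0 -/u => <-.
  by rewrite gaddNKg.
rewrite gaddA_gyr xw; set t := gyr _ _ w.
have -> : (u ⊕ x) ⊕ y = (x ⊕ y) ⊕ gshift x y u.
  by rewrite /gshift gaddNKg.
set s := gshift x y u in Ws *.
(* Invariance of [W] serves twice: it puts [t] in [W], and then writes [t] as a gyration of some
   [t'] in [W]. *)
have [t' Wt' <-] : (gyr (x ⊕ y) s @` W) t.
  by rewrite (gn_gyr NW); exact: gn_gyrM.
by apply: sVA; exists (s ⊕ t'); [exact: WV|rewrite gaddA_gyr].
Qed.

HB.instance Definition _ := isParaTopGyrogroup.Build T retop_gadd_continuous.

Lemma retop_nbhs_base x :
  nbhs_base x ((fun V : set G => [set x ⊕ v | v in V] : set T) @` gn_set N).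
Proof.
split=> [_ [V NV <-]|A [V NV sVA]]; first by exists V.
by exists [set x ⊕ v | v in V] => //; exists V.
Qed.

Lemma retop_gyr_invariant_base : exists B : set (set T), nbhs_base gzero B /\
  forall U, B U -> forall x y : T, gyr x y @` U = U.
Proof.
eexists; split; first exact: retop_nbhs_base.
move=> _ [V NV <-] x y.
have -> : [set gzero ⊕ v | v in V] = V.
  by rewrite -[RHS]image_id; apply: eq_imagel => v _; exact: gadd0g.
exact: (gn_gyr NV).
Qed.

HB.instance Definition _ :=
  isStronglyParaTopGyrogroup.Build T retop_gyr_invariant_base.

Lemma retop_first_countable :
  countable (gn_set N) -> first_countable T.
Proof.
move=> cN x; eexists; last exact: retop_nbhs_base.
exact: sub_countable (card_image_le _ _) cN.
Qed.

(** If [y] lies in all neighbourhoods of [x], then [n] lies in every [W], so [⊖ n] lies in every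
    [⊖ W] and hence in every [V]. *)
Lemma retop_symmetric :
  (forall V, gn_set N V -> \bigcap_(W in gn_set N) [set ⊖ w | w in W] `<=` V) ->
  forall x y, (forall A, nbhs x A -> A y) -> forall A, nbhs y A -> A x.
Proof.
move=> NN x y xy A [V NV sVA].
pose n : G := ⊖ x ⊕ y.
have Nn W : gn_set N W -> W n.
  move=> NW; have [|w Ww wy] := xy [set x ⊕ w | w in W]; first by exists W.
  by rewrite /n -wy gaddKg.
have VNn : V (⊖ n).
  by apply: NN => // W NW; exists n => //; exact: Nn.
(* As [y = x ⊕ n], adding [gyr x n (⊖ n)] to [y] gives [x ⊕ (n ⊕ ⊖ n) = x]. *)
apply: sVA; exists (gyr x n (⊖ n)); first exact: gn_gyrM.
by rewrite -[in LHS](gaddNKg x y) gyrKadd gaddgN gaddg0.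
Qed.

End GyroRetop.


(** * Sufficiency: countable families, quotients and the embedding *)

Lemma countable_setU (T : Type) (A B : set T) :
  countable A -> countable B -> countable (A `|` B).
Proof.
by move=> cA cB; rewrite -bigcup2E; apply: bigcup_countable => // -[|[|k]] _ //=.
Qed.

(** A Löwenheim-Skolem hull: add all [F x y] countably many times. Any two points of the union occur
    at a common stage, and the next stage contains their [F x y]. *)
Lemma countable_closure (T : Type) (P : set T) (F : T -> T -> set T) (x0 : T) :
  P x0 ->
  (forall x y, P x -> P y -> countable (F x y) /\ F x y `<=` P) ->
  exists C : set T, [/\ countable C, C x0, C `<=` P
    & forall x y, C x -> C y -> F x y `<=` C].
Proof.
move=> Px0 FP.
pose step S := S `|` \bigcup_(p in S `*` S) F p.1 p.2.
pose S n := iter n step [set x0].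
have S_le m n : (m <= n)%N -> S m `<=` S n.
  move=> /subnK <-; elim: (n - m)%N => [|k IH] //.
  by apply: subset_trans IH _; exact: subsetUl.
have SP n : countable (S n) /\ S n `<=` P.
  elim: n => [|n [cS sS]]; first by split; [exact: countable1|move=> _ ->].
  split.
    apply: countable_setU => //.
    apply: bigcup_countable => [|[x y] [/sS Px /sS Py]]; first exact: countableX.
    exact: (FP x y Px Py).1.
  move=> z [/sS //|[[x y] [/sS Px /sS Py]]].
  exact: (FP x y Px Py).2.
exists (\bigcup_n S n); split.
- by apply: bigcup_countable => // n _; exact: (SP n).1.
- by exists 0.
- by move=> x [n _]; exact: (SP n).2.
- move=> x y [m _ Sx] [n _ Sy] z Fz; exists (maxn m n).+1 => //; right.
  by exists (x, y) => //; split; [apply: S_le Sx|apply: S_le Sy];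
    rewrite ?leq_maxl ?leq_maxr.
Qed.

Section Construction.
Variable G : strongParaTopGyrogroupType.
Hypothesis Gbal : omega_balanced G.
Hypothesis GwHs : wHs_bound G [set: nat].

(** Each [V] in the invariant base [B] gets a countable [F V] inside [B] meeting all demands that a
    single member makes; a countable hull under [F] and shrunken intersections is then the required
    family. *)
Lemma exists_gyro_nbhds (U : set G) : nbhs gzero U ->
  exists N : gyro_nbhds G,
    [/\ countable (gn_set N), forall V, gn_set N V -> nbhs gzero V,
        forall V, gn_set N V ->
          \bigcap_(W in gn_set N) [set ⊖ w | w in W] `<=` V
      & exists2 V, gn_set N V & V `<=` U].
Proof.
move=> U0; have [B [[Bn Bb] Bgyr]] := @gyr_invariant_base G.
(* [r] shrinks a neighbourhood of [gzero] to a member of [B]; elsewhere its value is arbitrary. *)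
have /choice[r rP] (W : set G) : exists V, nbhs gzero W -> B V /\ V `<=` W.
  have [/Bb[V BV VW]|nW] := pselect (nbhs gzero W); first by exists V.
  by exists W.
pose refines (F : set (set G)) V := [/\ countable F /\ F `<=` B,
  (exists2 W, F W & forall a b, W a -> W b -> V (a ⊕ b)),
  (forall x y, exists2 W, F W & W `<=` gshift x y @^-1` V),
  (forall x y, exists2 W, F W & W `<=` gunshift x y @^-1` V)
  & \bigcap_(W in F) [set ⊖ w | w in W] `<=` V].
have /choice[F FP] (V : set G) : exists F, B V -> refines F V.
  have [/Bn V0|nV] := pselect (B V); last by exists set0.
  have [g [cg og [g1 g2]]] := Gbal V0; have [h [h0 ch hV]] := GwHs V0.
  have /nbhs_gadd[P [Q [P0 Q0 PQ]]] : nbhs (gzero ⊕ gzero : G) V.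
    by rewrite gadd0g.
  have gn W : g W -> nbhs gzero W by move=> /og/open_nbhs_nbhs.
  (* [g] serves subordination, [h] the weakly Hausdorff condition and [P] with [Q] the halving; [r]
     makes them all gyr-invariant. *)
  exists (r @` (g `|` (h `|` [set P `&` Q]))) => _.
  have rn W : (g `|` (h `|` [set P `&` Q])) W -> nbhs gzero W.
    by move=> [/gn|[/h0|->]] //; exact: filterI.
  split.
  - split; last by move=> _ [W /rn/rP[BW _] <-].
    apply: sub_countable (card_image_le _ _) _.
    by do 2![apply: countable_setU => //]; exact: countable1.
  - have [_ rPQ] := rP _ (filterI P0 Q0).
    exists (r (P `&` Q)); first by exists (P `&` Q) => //; right; right.
    by move=> a b /rPQ[Pa _] /rPQ[_ Qb]; exact: PQ.
  - move=> x y; have [W gW sW] := g1 x y; have [_ rW] := rP _ (gn _ gW).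
    exists (r W); first by exists W => //; left.
    by move=> w /rW Ww; apply: sW; exists w.
  - move=> x y; have [W gW] := g2 x y; have [_ rW] := rP _ (gn _ gW).
    rewrite image_gshift => sW.
    by exists (r W); [exists W => //; left|exact: subset_trans sW].
  - move=> v iv; apply: hV => W hW; have [_ rW] := rP _ (h0 _ hW).
    have [|w /rW Ww <-] := iv (r W); last by exists w.
    by exists W => //; right; left.
(* One binary operation encodes both closure under [F] and closure under intersections. *)
pose F2 V W := F V `|` [set r (V `&` W)].
have [BU rU] := rP _ U0.
have [C [cC CU CB CF]] : exists C : set (set G),
    [/\ countable C, C (r U), C `<=` B & forall V W, C V -> C W -> F2 V W `<=` C].
  apply: countable_closure => // V W BV BW; have [[cF FB] _ _ _ _] := FP _ BV.
  split; first by apply: countable_setU => //; exact: countable1.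
  move=> X [/FB//|->]; have [] // := rP (V `&` W).
  by apply: filterI; exact: Bn.
have CF' V : C V -> F V `<=` C by move=> CV W FW; apply: (CF V V) => //; left.
have Czero V : C V -> V gzero by move=> /CB/Bn; exact: nbhs_singleton.
have CI V W : C V -> C W -> exists2 X, C X & X `<=` V `&` W.
  move=> CV CW; exists (r (V `&` W)); first by apply: (CF V W) => //; right.
  by have [] := rP (V `&` W) (filterI (Bn _ (CB _ CV)) (Bn _ (CB _ CW))).
have Cadd V : C V -> exists2 W, C W & forall a b, W a -> W b -> V (a ⊕ b).
  move=> CV; have [_ [W FW WV] _ _ _] := FP _ (CB _ CV).
  by exists W => //; exact: CF' FW.
have Cshift V : C V -> forall x y, exists2 W, C W & W `<=` gshift x y @^-1` V.
  move=> CV x y; have [_ _ /(_ x y)[W FW WV] _ _] := FP _ (CB _ CV).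
  by exists W => //; exact: CF' FW.
have Cunshift V : C V ->
    forall x y, exists2 W, C W & W `<=` gunshift x y @^-1` V.
  move=> CV x y; have [_ _ _ /(_ x y)[W FW WV] _] := FP _ (CB _ CV).
  by exists W => //; exact: CF' FW.
exists (@GyroNbhds G C (ex_intro _ _ CU) Czero CI Cadd
  (fun V CV => Bgyr V (CB V CV)) Cshift Cunshift) => /=; split=> //.
- by move=> V /CB/Bn.
- move=> V CV; have [_ _ _ _ iF] := FP _ (CB _ CV).
  by move=> v iv; apply: iF => W FW; apply: iv; exact: CF' FW.
- by exists (r U).
Qed.

Lemma exists_first_countable_quotient (U : set G) : nbhs gzero U ->
  exists (H : strongParaTopGyrogroupType) (f : G -> H),
    [/\ first_countable H, accessible_space H, {morph f : x y / x ⊕ y},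
        continuous f & exists2 W, nbhs gzero W & f @^-1` W `<=` U].
Proof.
move=> /exists_gyro_nbhds[N [cN Nn NN [V NV VU]]].
pose T : strongParaTopGyrogroupType := gyro_retop N.
exists (t0quot T), (@t0pi T); split.
- exact/t0quot_first_countable/retop_first_countable.
- by apply: t0quot_accessible; exact: (retop_symmetric NN).
- by move=> x y; rewrite -[RHS]/(t0_gadd _ _) t0piD.
- move=> x A /nbhs_t0pi[W NW sWA].
  apply/nbhs_gtranslate; apply: filterS (Nn _ NW) => w Ww.
  by apply: sWA; exists w.
have V0 : nbhs (gzero : T) V.
  by exists V => // _ [v Vv <-]; rewrite gadd0g.
have [W W0 WV] := nbhs_t0pi_preimage V0.
by exists W => //; exact: subset_trans WV VU.
Qed.

Lemma embedding_of_omega_balanced : accessible_space G ->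
  exists (I : Type) (H : I -> strongParaTopGyrogroupType)
      (S : subgyrogroup (prod_topology H)),
    (forall i, first_countable (H i) /\ accessible_space (H i)) /\
    topologically_isomorphic G (set_type S).
Proof.
move=> GT1; pose I := {U : set G | nbhs gzero U}.
have quot (i : I) : {H : strongParaTopGyrogroupType & {f : G -> H |
    [/\ first_countable H, accessible_space H, {morph f : x y / x ⊕ y},
        continuous f & exists2 W, nbhs gzero W & f @^-1` W `<=` sval i]}}.
  case: i => U /= /exists_first_countable_quotient/cid[H /cid[f ?]].
  by exists H, f.
pose H i := projT1 (quot i); pose f i : G -> H i := sval (projT2 (quot i)).
have [f1 fT1 fD fC fU] : [/\ forall i, first_countable (H i),
    forall i, accessible_space (H i), forall i, {morph f i : x y / x ⊕ y},
    forall i, continuous (f i)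
    & forall i, exists2 W, nbhs gzero W & f i @^-1` W `<=` sval i].
  by split=> i; have [] := svalP (projT2 (quot i)).
pose phi x : prod_topology H := fun i => f i x.
have phiD : {morph phi : x y / x ⊕ y}.
  by move=> x y; apply: functional_extensionality_dep => i; exact: fD.
(* The translate of [A] to [gzero] is itself the index of the coordinate. Separation by one
   coordinate gives injectivity, using T1, and later the continuity of the inverse. *)
have phi_nbhs x A : nbhs x A -> exists (i : I) (W : set (H i)),
    nbhs (f i x) W /\ f i @^-1` W `<=` A.
  move=> /nbhs_gtranslate A0; pose i : I := exist _ _ A0.
  have [W W0 sWA] := fU i; exists i, (gadd (⊖ f i x) @^-1` W); split.
    by apply/nbhs_gtranslate; apply: filterS W0 => w /=; rewrite gaddKg.
  move=> y /=; rewrite -(gmorphN (@fD i)) -fD => /sWA /=.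
  by rewrite gaddNKg.
have phi_inj : injective phi.
  move=> x y xy; apply: accessible_nbhs => // A /phi_nbhs[i [W [xW]]]; apply.
  by have : W (phi x i) := nbhs_singleton xW; rewrite xy.
have S0 : range phi !=set0 by exists (phi gzero), gzero.
have SD a b : range phi a -> range phi b -> range phi (a ⊕ b).
  by move=> [x _ <-] [y _ <-]; exists (x ⊕ y).
have SN a : range phi a -> range phi (⊖ a).
  by move=> [x _ <-]; exists (⊖ x) => //; rewrite gmorphN.
pose S : subgyrogroup (prod_topology H) := Subgyrogroup S0 SD SN.
exists I, H, S; split=> //.
pose F x : set_type S := exist _ (phi x) (mem_set (imageT phi x)).
exists F; split.
- by move=> x y; apply: val_inj; exact: phiD.
- move=> x A /nbhs_set_type[B xB sBA].
  have phix : phi @ x --> phi x.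
    by apply/cvg_prod_topology => i V; exact: fC.
  apply: (@filterS _ _ _ (phi @^-1` B)); last exact: phix.
  by move=> y; exact: (sBA (F y)).
have inv (s : set_type S) : {x | phi x = set_val s}.
  by apply: cid; have [x _ xs] := set_valP s; exists x.
have FK : cancel F (fun s => sval (inv s)).
  by move=> x; apply: phi_inj; exact: svalP (inv (F x)).
have KF : cancel (fun s => sval (inv s)) F.
  by move=> s; apply: val_inj; exact: svalP (inv s).
exists (fun s => sval (inv s)); split=> // s A.
rewrite -(KF s) FK => /phi_nbhs[i [W [sW WA]]].
apply/nbhs_set_type; exists [set h | W (h i)] => [|r /= Wr].
  have /cvg_prod_topology : nbhs (phi (sval (inv s))) --> phi (sval (inv s)) by [].
  exact.
by apply: WA; rewrite -(KF r) in Wr.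
Qed.

End Construction.

Theorem theorem3p23 (G : strongParaTopGyrogroupType) :
  (exists (I : Type) (H : I -> strongParaTopGyrogroupType)
          (S : subgyrogroup (prod_topology H)),
      (forall i, first_countable (H i) /\ accessible_space (H i)) /\
      topologically_isomorphic G (set_type S))
  <->
  [/\ accessible_space G,
      omega_balanced G
    & wHs_le G [set: nat]].
Proof.
split=> [[I [H [S [H1 [f fiso]]]]]|[GT1 Gbal /wHs_le_nat GwHs]]; last first.
  exact: embedding_of_omega_balanced.
(* The same family at [U] yields both [omega_balanced] and the countable bound. *)
have Gsub := embedded_countably_subordinated H1 fiso.
split; first exact: embedded_accessible H1 fiso.
- by move=> U /Gsub[g [cg og sg _]]; exists g.
- apply/wHs_le_nat => U /Gsub[g [cg og _ ig]]; exists g; split=> //.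
  by move=> V /og/open_nbhs_nbhs.
Qed.
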